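(* Let $A$ be a ring and let $\mathcal{R}$ be an equivalence relation on $A$. Then $\mathcal{R}$ is a zero-divisor relation if and only if $\mathcal{R}$ is finer than $\asymp$, i.e. for all $a,b\in A$, $a\,\mathcal{R}\,b$ implies $a\asymp b$.
   Context: All rings are commutative and unitary. For $a\in A$, $\operatorname{Ann}(a)=\{c\in A: ca=0\}$. For $a,b\in A$, $a\asymp b$ means $\operatorname{Ann}(a)=\operatorname{Ann}(b)$. An equivalence relation $\mathcal{R}$ on $A$ is called a zero-divisor relation if, whenever $a\,\mathcal{R}\,a'$ and $b\,\mathcal{R}\,b'$, one has that $ab=0$ implies $a'b'=0$. *)

(* Defs.v *)
From mathcomp Require Import all_boot all_algebra.
From mathcomp Require Import boolp classical_sets.
From Stdlib Require Import RelationClasses.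

Set Implicit Arguments.
Unset Strict Implicit.
Unset Printing Implicit Defensive.

Import GRing.Theory.

Local Open Scope classical_set_scope.
Local Open Scope ring_scope.

(* The rings are [comPzRingType]s, so the zero ring is allowed. *)

Definition Ann (A : comPzRingType) (a : A) : set A := [set c | c * a = 0].

Definition asymp (A : comPzRingType) (a b : A) : Prop := Ann a = Ann b.

Definition zero_divisor_relation (A : comPzRingType) (R : A -> A -> Prop) : Prop :=
  Equivalence R /\
  forall a a' b b' : A, R a a' -> R b b' -> a * b = 0 -> a' * b' = 0.

(* Main.v *)
Require Import Defs.
From mathcomp Require Import all_boot all_algebra.
From mathcomp Require Import classical_sets.
From Stdlib Require Import RelationClasses.

Import GRing.Theory.

(** Membership in [Ann b] is the vanishing of a product with [b], so replacing
    [b] by [b'] in a zero product is harmless exactly when the annihilators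
    agree.  By commutativity the two factors can be replaced one at a time. *)
Theorem proposition2p4 (A : comPzRingType) (R : A -> A -> Prop)
    (HR : Equivalence R) :
  zero_divisor_relation R <-> (forall a b : A, R a b -> asymp a b).
Proof.
split=> [[_ zdR] a b Rab | finer].
  (* Reflexivity leaves the annihilating factor [c] unchanged, and symmetry
     gives the second inclusion. *)
  apply/seteqP; split=> c.
    exact: zdR (reflexivity c) Rab.
  exact: zdR (reflexivity c) (symmetry Rab).
split=> // a a' b b' /finer annaa' /finer annbb' ab0.
have ab'0 : Ann b' a by rewrite -annbb'.
have : Ann a' b' by rewrite -annaa' /Ann /= mulrC.
by rewrite /Ann /= mulrC.
Qed.
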